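(* Let $X$ and $Y$ be Hausdorff topological spaces. If $X$ is a Gruenhage space and $f:X\to Y$ is a perfect, surjective mapping, then $Y$ is also a Gruenhage space.
   Context: A topological space $X$ is a Gruenhage space if there exist families $(\mathscr{U}_n)_{n\in\mathbb{N}}$ of open subsets of $X$ such that for any distinct $x,y\in X$ there exist $n\in\mathbb{N}$ and $U\in\mathscr{U}_n$ with: (i) $U\cap\{x,y\}$ is a singleton; (ii) either $x$ lies in only finitely many $U'\in\mathscr{U}_n$ or $y$ lies in only finitely many $U'\in\mathscr{U}_n$. A mapping is perfect if it is continuous, closed, and has compact fibres. *)

(* Defs.v *)
From mathcomp Require Import all_boot.
From mathcomp Require Import boolp classical_sets functions cardinality.
From mathcomp Require Import filter topology.

Set Implicit Arguments.
Unset Strict Implicit.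
Unset Printing Implicit Defensive.

Local Open Scope classical_set_scope.

Definition gruenhage_space (X : topologicalType) : Prop :=
  exists UU : nat -> set (set X),
    (forall n U, UU n U -> open U) /\
    (forall x y : X, x <> y ->
       exists n U,
         [/\ UU n U,
             exists z : X, U `&` [set x; y] = [set z] &
             finite_set [set U' | UU n U' /\ U' x] \/
             finite_set [set U' | UU n U' /\ U' y]]).

(* Surjectivity is not part of perfectness. *)
Definition perfect_map (X Y : topologicalType) (f : X -> Y) : Prop :=
  [/\ continuous f,
      forall C : set X, closed C -> closed (f @` C) &
      forall y : Y, compact (f @^-1` [set y])].

(* Main.v *)
(** A Gruenhage space carries countably many "sunflower" families [W n] of open
    sets, any two distinct members of which meet inside an open kernel [R n], and
    which together separate points in the T0 sense: for each
    family and each [m], take as kernel the points lying in more than [m] members,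
    and add it to the intersections of [m] members.

    Let [F] and [G] be two disjoint fibres.  At stage [n], given a closed set [K]
    meeting both, try to cover [K `&` F] by [R n] and as few as possible, say [k],
    members of [W n].  Minimality makes such a cover unique, so that the open sets
    it produces catch [F] only finitely often, and if they do not distinguish [F]
    from [G], then the same members cover [K `&` G].  Remove from [K] the kernel
    and all members of the cover but one; if there is no cover, remove the whole
    union of [W n].  By minimality the new [K] still meets [F] and [G], and no
    member of [W n] separates two points of it.  Since finitely many sets [K] are
    alive at each stage, compactness yields points of [F] and [G] that are not
    separated by any [W n], which is absurd. *)

Require Import Defs.
From mathcomp Require Import all_boot finmap.
From mathcomp Require Import boolp classical_sets functions cardinality.
From mathcomp Require Import filter topology.

Local Open Scope classical_set_scope.

(** * Sunflower families from a Gruenhage structure *)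

Notation union_of A := (\bigcup_(U in A) U).

Definition sunflower_families {X : topologicalType}
    (W : nat -> set (set X)) (R : nat -> set X) : Prop :=
  [/\ forall n, open (R n),
      forall n U, W n U -> open U /\ R n `<=` U &
      forall n U V, W n U -> W n V -> U <> V -> U `&` V `<=` R n].

Definition agree {T : Type} (W : set (set T)) (x y : T) : Prop :=
  forall U, W U -> (U x <-> U y).

Lemma separates_setI1P {T : Type} (U : set T) (x y : T) : x <> y ->
  (exists z, U `&` [set x; y] = [set z]) <-> ~ (U x <-> U y).
Proof.
move=> xy; split.
  move=> [z Uz] [Uxy Uyx].
  have [Uz' [zx|zy]] : (U `&` [set x; y]) z by rewrite Uz.
    have : (U `&` [set x; y]) y by split; [apply: Uxy; rewrite -zx|right].
    by rewrite Uz /= => yz; apply: xy; rewrite -zx yz.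
  have : (U `&` [set x; y]) x by split; [apply: Uyx; rewrite -zy|left].
  by rewrite Uz /= => yz; apply: xy; rewrite -zy yz.
move=> nUxy; have [Ux|nUx] := pselect (U x).
  exists x; apply/seteqP; split => [t [Ut [->//|ty]]|t ->]; last by split; [|left].
  by rewrite ty in Ut; case: nUxy.
have [Uy|nUy] := pselect (U y); last by case: nUxy.
exists y; apply/seteqP; split => [t [Ut [tx|->//]]|t ->]; last by split; [|right].
by rewrite tx in Ut.
Qed.

(** Finite witnesses avoid counting in infinite families and exhibit the set as a union of finite
    intersections, hence open when the members of [A] are. *)
Definition deep {T : Type} (A : set (set T)) (m : nat) : set T :=
  [set x | exists J : {fset set T},
     [/\ [set` J] `<=` A, m < #|` J| & forall U, U \in J -> U x]].

(** The kernel is itself a member, so agreement on the family includes agreement on the kernel. *)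
Definition meets {T : Type} (A : set (set T)) (m : nat) : set (set T) :=
  [set V | V = deep A m \/ exists J : {fset set T},
     [/\ [set` J] `<=` A, #|` J| = m &
         V = \bigcap_(U in [set` J]) U `|` deep A m]].

Lemma open_bigcap_fset {X : topologicalType} (J : {fset set X}) :
  (forall U, U \in J -> open U) -> open (\bigcap_(U in [set` J]) U).
Proof.
move=> Jo; rewrite -closedC setC_bigcap; apply: closed_bigcup => [|U JU].
  exact: finite_fset.
exact/open_closedC/Jo.
Qed.

Lemma open_deep {X : topologicalType} (A : set (set X)) (m : nat) :
  (forall U, A U -> open U) -> open (deep A m).
Proof.
move=> Ao.
have -> : deep A m =
    \bigcup_(J in [set J : {fset set X} | [set` J] `<=` A /\ m < #|` J|])
      \bigcap_(U in [set` J]) U.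
  apply/seteqP; split => [x [J [JA mJ Jx]]|x [J [JA mJ] Jx]].
    by exists J => // U /Jx.
  by exists J; split => // U /Jx.
apply: bigcup_open => J [JA _]; apply: open_bigcap_fset => U UJ.
exact/Ao/JA.
Qed.

(** The union of two distinct [m]-element subfamilies has more than [m] elements. *)
Lemma meets_disjoint {T : Type} (A : set (set T)) (m : nat) (U V : set T) :
  meets A m U -> meets A m V -> U <> V -> U `&` V `<=` deep A m.
Proof.
move=> [->|[I [IA Im ->]]] [->|[J [JA Jm ->]]] UV x [] //.
move=> [Ix|//] [Jx|//].
have IJ : I <> J by move=> E; apply: UV; rewrite E.
exists (I `|` J)%fset; split.
- by move=> U' /=; rewrite in_fsetU => /orP[/IA|/JA].
- rewrite ltnNge; apply/negP => IJm; apply: IJ.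
  have -> : I = (I `|` J)%fset.
    by apply/eqP; rewrite eqEfcard fsubsetUl Im.
  by apply/eqP; rewrite eq_sym eqEfcard fsubsetUr Jm.
- by move=> U'; rewrite in_fsetU => /orP[/Ix|/Jx].
Qed.

(** Let [m] be the number of members containing [x]. Agreement puts [y] into all of them but outside
    the kernel, so no further member contains [y]. *)
Lemma meets_separate {T : Type} (A : set (set T)) (x y : T) :
  finite_set [set U | A U /\ U x] ->
  (forall m, agree (meets A m) x y) -> agree A x y.
Proof.
move=> /finite_fsetP[I IE] xy.
have IP U : (U \in I) <-> A U /\ U x.
  by rewrite -[_ /\ _]/([set U | A U /\ U x] U) IE.
have IA : [set` I] `<=` A by move=> U /IP[].
have nx : ~ deep A #|` I| x.
  move=> [J [JA IJ Jx]]; move: IJ; rewrite ltnNge => /negP; apply.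
  by apply/fsubset_leq_card/fsubsetP => U UJ; apply/IP; split; [exact: JA|exact: Jx].
have ny : ~ deep A #|` I| y by have [_ h] := xy #|` I| _ (or_introl erefl) => /h.
have Iy : (\bigcap_(U in [set` I]) U) y.
  pose V := \bigcap_(U in [set` I]) U `|` deep A #|` I|.
  have [VxVy _] : V x <-> V y by apply: (xy #|` I|); right; exists I.
  by have [|//|/ny] := VxVy; first by left => U /IP[].
move=> U AU; split => [Ux|Uy]; first by apply: Iy; apply/IP.
apply: contrapT => nUx; apply: ny; exists (U |` I)%fset; split.
- by move=> V /=; rewrite in_fset1U => /orP[/eqP->|/IA].
- have UI : U \notin I by apply/negP => /IP[].
  by rewrite cardfsU1 UI.
- by move=> V; rewrite in_fset1U => /orP[/eqP->|/Iy].
Qed.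

Lemma gruenhage_sunflower {X : topologicalType} : gruenhage_space X ->
  exists W R, @sunflower_families X W R /\
    forall x y : X, (forall n, agree (W n) x y) -> x = y.
Proof.
move=> [UU [UUo UUsep]].
(* A single index runs through all pairs [(n, m)]; the default merely repeats a family. *)
pose nm i : nat * nat := odflt (0, 0) (choice.unpickle i).
exists (fun i => meets (UU (nm i).1) (nm i).2).
exists (fun i => deep (UU (nm i).1) (nm i).2); split; first split.
- by move=> i; apply: open_deep => U; exact: UUo.
- move=> i U [->|[J [JU Jm ->]]]; split => //.
  + by apply: open_deep => V; exact: UUo.
  + apply: openU; last by apply: open_deep => V; exact: UUo.
    by apply: open_bigcap_fset => V VJ; apply: UUo; exact: JU VJ.
- by move=> i U V; exact: meets_disjoint.
move=> x y xy; apply: contrapT => nxy.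
have xy' n m : agree (meets (UU n) m) x y.
  by have := xy (choice.pickle (n, m)); rewrite /nm choice.pickleK.
have [n [U [UnU /separates_setI1P - /(_ nxy) + [|]]]] := UUsep _ _ nxy => nU fin.
  by apply: nU; apply: (meets_separate _ _ _ fin (xy' n)).
have yx m : agree (meets (UU n) m) y x.
  by move=> V VU; apply: iff_sym; exact: (xy' n m).
by apply: nU; apply: iff_sym; apply: (meets_separate _ _ _ fin yx).
Qed.

(** * Finite subcovers and configurations *)

Lemma compact_fset_cover {X : topologicalType} (A : set X) (W : set (set X)) :
  compact A -> (forall U, W U -> open U) -> A `<=` union_of W ->
  exists J : {fset set X}, [set` J] `<=` W /\ A `<=` union_of [set` J].
Proof.
move=> /compact_near_coveringP Ac Wo AW.
(* The filter of eventual properties of growing finite subfamilies of [W]. *)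
pose F : set_system {fset set X} := [set S | exists J : {fset set X},
  [set` J] `<=` W /\ forall K, (J `<=` K)%fset -> S K].
have FF : Filter F.
  split; first by exists fset0; split => // U; rewrite /= inE.
  - move=> P Q [I [IW IP]] [J [JW JQ]]; exists (I `|` J)%fset; split.
      by move=> U /=; rewrite in_fsetU => /orP[/IW|/JW].
    move=> K; rewrite fsubUset => /andP[IK JK]; split; [exact: IP|exact: JQ].
  - move=> P Q PQ [I [IW IP]]; exists I; split => // K IK; exact/PQ/IP.
have [] := Ac _ F (fun J => union_of [set` J]) FF.
  move=> x /AW[U WU Ux].
  exists (U, [set J : {fset set X} | U \in J]).
    split => /=; first by apply: open_nbhs_nbhs; split => //; exact: Wo.
    exists [fset U]%fset; split => [V /=|K]; first by rewrite in_fset1 => /eqP->.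
    by rewrite fsub1set.
  by move=> [y J] /= [Uy UJ]; exists U.
move=> J [JW JP]; exists J; split => //; exact: JP.
Qed.

(** A configuration is a pair of an open set and of the closed set [K] left to
    examine.  The head of [s] is the latest stage: [Some k] records a cover by [k]
    members, [None] the absence of a cover.  The open components along a history
    are intersected so that catching a set means having caught it at every earlier
    stage. *)
Fixpoint config {X : Type} (W : nat -> set (set X)) (R : nat -> set X)
    (s : seq (option nat)) : set (set X * set X) :=
  match s with
  | [::] => [set (setT, setT)]
  | None :: s' => [set (c.1, c.2 `\` union_of (W (size s'))) | c in config W R s']
  | Some k :: s' => [set d | exists c (J : {fset set X}),
      [/\ config W R s' c, [set` J] `<=` W (size s'), #|` J| = k,
          d.1 = c.1 `&` (~` c.2 `|` (R (size s') `|` union_of [set` J])) &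
          (J = fset0 /\ d.2 = c.2) \/ exists2 U, U \in J &
            d.2 = c.2 `\` (R (size s') `|` union_of [set` (J `\ U)%fset])]]
  end.

(** For a fibre [F], finiteness of this set will give local finiteness at the corresponding point of
    the target space. *)
Definition caught {X : Type} (W : nat -> set (set X)) (R : nat -> set X)
    (s : seq (option nat)) (F : set X) : set (set X * set X) :=
  [set c | config W R s c /\ F `<=` c.1].

Lemma config_open_closed {X : topologicalType} (W : nat -> set (set X))
    (R : nat -> set X) (s : seq (option nat)) (c : set X * set X) :
  sunflower_families W R -> config W R s c -> open c.1 /\ closed c.2.
Proof.
move=> [Ro Wo _].
have openJ n (J : {fset set X}) : [set` J] `<=` W n ->
    open (R n `|` union_of [set` J]).
  move=> JW; apply: openU => //; apply: bigcup_open => U UJ.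
  by have [] := Wo _ _ (JW _ UJ).
elim: s c => [|[k|] s IH] c /=.
- by move=> ->; split; [exact: openT|exact: closedT].
- move=> [b [J [/IH[bo bc] JW Jk -> E]]]; split.
    by apply: openI => //; apply: openU; [exact: closed_openC|exact: openJ].
  case: E => [[_ ->]//|[U UJ ->]].
  apply: closedI => //; apply: open_closedC; apply: openJ => V /=.
  by rewrite in_fsetD1 => /andP[_]; exact: JW.
- move=> [b /IH[bo bc] <-] /=; split => //.
  apply: closedI => //; apply: open_closedC; apply: bigcup_open => U WU.
  by have [] := Wo _ _ WU.
Qed.

Lemma config_parent {X : Type} (W : nat -> set (set X)) (R : nat -> set X)
    (o : option nat) (s : seq (option nat)) (d : set X * set X) :
  config W R (o :: s) d ->
  exists c, [/\ config W R s c, d.1 `<=` c.1 & d.2 `<=` c.2].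
Proof.
case: o => [k|] /=.
  move=> [c [J [sc _ _ -> E]]]; exists c; split => //.
  by case: E => [[_ ->]//|[U _ ->] x []].
by move=> [c sc <-] /=; exists c; split.
Qed.

(** Without a cover, both points avoid all members. With an empty cover, both lie in the kernel,
    hence in every member. Otherwise both lie in the kept member [U] and outside the kernel, hence
    in no other member. *)
Lemma config_agree {X : topologicalType} (W : nat -> set (set X))
    (R : nat -> set X) (o : option nat) (s : seq (option nat))
    (d : set X * set X) (x y : X) :
  sunflower_families W R -> config W R (o :: s) d ->
  (d.1 `&` d.2) x -> (d.1 `&` d.2) y -> agree (W (size s)) x y.
Proof.
move=> [_ Wo Wd] + [x1 x2] [y1 y2].
case: o => [k|] /=; last first.
  move=> [c sc E]; move: x2 y2; rewrite -E /= => -[_ xW] [_ yW] U WU.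
  by split => [Ux|Uy]; [case: xW|case: yW]; exists U.
move=> [c [J [sc JW _ d1 d2]]].
have d2c : d.2 `<=` c.2 by case: d2 => [[_ ->]//|[U _ ->] t []].
move: (x1) (y1).
rewrite d1 => -[_ [/(_ (d2c _ x2))//|xJ]] [_ [/(_ (d2c _ y2))//|yJ]].
case: d2 => [[J0 _]|[U UJ d2]].
  have R_of t : (R (size s) `|` union_of [set` J]) t -> R (size s) t.
    by rewrite J0 => -[//|[U]]; rewrite /= inE.
  by move=> U WU; have [_ RU] := Wo _ _ WU; split=> _; apply: RU; exact: R_of.
have petal t : (R (size s) `|` union_of [set` J]) t -> d.2 t ->
    forall V, W (size s) V -> (V t <-> V = U).
  move=> tJ; rewrite d2 => -[_ nt].
  have Ut : U t.
    case: tJ => [Rt|[V /= VJ Vt]]; first by case: nt; left.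
    have [<-//|/eqP VU] := pselect (V = U).
    by case: nt; right; exists V => //=; rewrite in_fsetD1 VU.
  move=> V WV; split => [Vt|->//]; apply: contrapT => VU.
  by case: nt; left; apply: (Wd _ V U) => //; exact: JW.
by move=> V WV; rewrite (petal x) // (petal y).
Qed.

(** * Minimal covers and the passage to the next stage *)

Lemma minimal_cover_unique {X : Type} (A : set X) (W : set (set X)) (R : set X)
    (k : nat) (I J : {fset set X}) :
  (forall U V, W U -> W V -> U <> V -> U `&` V `<=` R) ->
  (forall K : {fset set X}, [set` K] `<=` W -> A `<=` R `|` union_of [set` K] ->
     k <= #|` K|) ->
  [set` I] `<=` W -> [set` J] `<=` W -> #|` I| = k -> #|` J| = k ->
  A `<=` R `|` union_of [set` I] -> A `<=` R `|` union_of [set` J] -> I = J.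
Proof.
move=> Wd kmin IW JW Ik Jk AI AJ.
(* A point outside the kernel lies in only one member, so the common members already cover. *)
have kIJ : k <= #|` (I `&` J)%fset|.
  apply: kmin => [U /=|x Ax]; first by rewrite in_fsetI => /andP[/IW].
  have [Rx|[U UI Ux]] := AI x Ax; first by left.
  have [Rx|[V VJ Vx]] := AJ x Ax; first by left.
  have [E|UV] := pselect (U = V); last first.
    by left; apply: (Wd U V) => //; [exact: IW|exact: JW].
  by right; exists U => //=; rewrite in_fsetI; apply/andP; split; [|rewrite E].
have EI : (I `&` J)%fset = I by apply/eqP; rewrite eqEfcard fsubsetIl Ik.
have EJ : (I `&` J)%fset = J by apply/eqP; rewrite eqEfcard fsubsetIr Jk.
by rewrite -EI EJ.
Qed.

(** The invariant kept while descending through the stages. *)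
Definition linked {X : Type} (W : nat -> set (set X)) (R : nat -> set X)
    (F G : set X) (s : seq (option nat)) : Prop :=
  [/\ finite_set (caught W R s F), caught W R s F !=set0,
      caught W R s F = caught W R s G &
      forall c, caught W R s F c -> c.2 `&` F !=set0 /\ c.2 `&` G !=set0].

Lemma caught_Some {X : Type} (W : nat -> set (set X)) (R : nat -> set X)
    (k : nat) (s : seq (option nat)) (F : set X) (d : set X * set X) :
  caught W R (Some k :: s) F d ->
  exists c (J : {fset set X}),
  [/\ caught W R s F c, [set` J] `<=` W (size s) /\ #|` J| = k,
      d.1 = c.1 `&` (~` c.2 `|` (R (size s) `|` union_of [set` J])),
      (J = fset0 /\ d.2 = c.2) \/ exists2 U, U \in J &
        d.2 = c.2 `\` (R (size s) `|` union_of [set` (J `\ U)%fset]) &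
      c.2 `&` F `<=` R (size s) `|` union_of [set` J]].
Proof.
move=> [[c [J [sc JW Jk d1 d2]]] Fd]; exists c, J; split => //.
  by split => // x /Fd; rewrite d1 => -[].
by move=> x [cx /Fd]; rewrite d1 => -[_ []].
Qed.

(** Over each parent the minimal cover is unique, and a child is then determined by the member kept,
    if any. *)
Lemma finite_caught_Some {X : topologicalType} (W : nat -> set (set X))
    (R : nat -> set X) (k : nat) (s : seq (option nat)) (F : set X) :
  sunflower_families W R -> finite_set (caught W R s F) ->
  (forall c (K : {fset set X}), caught W R s F c -> [set` K] `<=` W (size s) ->
     c.2 `&` F `<=` R (size s) `|` union_of [set` K] -> k <= #|` K|) ->
  finite_set (caught W R (Some k :: s) F).
Proof.
move=> [_ _ Wd] fin kmin; set n := size s in kmin.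
pose D c := [set d : set X * set X | exists J : {fset set X},
  [/\ [set` J] `<=` W n /\ #|` J| = k,
      d.1 = c.1 `&` (~` c.2 `|` (R n `|` union_of [set` J])),
      (J = fset0 /\ d.2 = c.2) \/ exists2 U, U \in J &
        d.2 = c.2 `\` (R n `|` union_of [set` (J `\ U)%fset]) &
      c.2 `&` F `<=` R n `|` union_of [set` J]]].
apply: (@sub_finite_set _ _ (\bigcup_(c in caught W R s F) D c)).
  by move=> d /caught_Some[c [J [cF JW d1 d2 FJ]]]; exists c => //; exists J.
apply: bigcup_finite => // c cF.
have [[d0 [J0 [[J0W J0k] _ _ FJ0]]]|noJ] := pselect (D c !=set0); last first.
  by apply: (@sub_finite_set _ _ set0) => // d Dd; case: noJ; exists d.
pose w := c.1 `&` (~` c.2 `|` (R n `|` union_of [set` J0])).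
apply: (@sub_finite_set _ _ ([set (w, c.2)] `|`
    [set (w, c.2 `\` (R n `|` union_of [set` (J0 `\ U)%fset])) | U in [set` J0]])).
  move=> [d1 d2] [J [[JW Jk] /= d1E E FJ]].
  have EJ : J = J0.
    apply: (minimal_cover_unique _ _ _ _ _ _ (Wd n) _ JW J0W Jk J0k FJ FJ0).
    by move=> K; exact: kmin.
  rewrite {}d1E /w -EJ; case: E => [[_ ->]|[U UJ ->]]; first by left.
  by right; exists U.
rewrite finite_setU; split; first exact: finite_set1.
by apply: finite_image; exact: finite_fset.
Qed.

Lemma linked_extend {X : topologicalType} (W : nat -> set (set X))
    (R : nat -> set X) (F G : set X) (s : seq (option nat)) :
  sunflower_families W R -> compact F -> compact G ->
  (forall t, finite_set (caught W R t F) -> caught W R t F = caught W R t G) ->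
  linked W R F G s -> exists o, linked W R F G (o :: s).
Proof.
move=> WR Fc Gc FG [fin [c0 c0F] sFG meet]; have [_ Wo Wd] := WR.
set n := size s.
(* Minimising over all caught configurations and both fibres at once gives one [k] that serves [F]
   and [G] alike. *)
pose P k := `[< exists c (J : {fset set X}), [/\ caught W R s F c,
  [set` J] `<=` W n, #|` J| = k &
  c.2 `&` F `<=` R n `|` union_of [set` J] \/
  c.2 `&` G `<=` R n `|` union_of [set` J]] >].
have [exP|nP] := pselect (exists k, P k); last first.
  (* If [W n] covered the part of [K] in [c.2], a finite subcover would make some [P k] true. *)
  have out (K : set X) c : compact K -> caught W R s F c ->
      (forall J : {fset set X}, c.2 `&` K `<=` R n `|` union_of [set` J] ->
         c.2 `&` F `<=` R n `|` union_of [set` J] \/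
         c.2 `&` G `<=` R n `|` union_of [set` J]) ->
      (c.2 `\` union_of (W n)) `&` K !=set0.
    move=> Kc cF KFG; apply: contrapT => e; apply: nP.
    have [_ c2] : open c.1 /\ closed c.2 by apply: config_open_closed WR cF.1.
    have [|U /Wo[]//|x [Kx cx]|J [JW KJ]] := @compact_fset_cover _ (K `&` c.2) (W n).
    - exact: compact_closedI.
    - by apply: contrapT => nx; apply: e; exists x.
    exists #|` J|; apply/asboolP; exists c, J; split => //; apply: KFG => x [cx Kx].
    by right; apply: KJ.
  exists None.
  have sub d : caught W R (None :: s) F d -> exists2 c, caught W R s F c &
      d = (c.1, c.2 `\` union_of (W n)).
    by move=> [[c sc <-] Fd]; exists c.
  have fin' : finite_set (caught W R (None :: s) F).
    apply: (@sub_finite_set _ _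
      [set (c.1, c.2 `\` union_of (W n)) | c in caught W R s F]).
      by move=> d /sub[c cF ->]; exists c.
    exact: finite_image.
  split => //; last 2 first.
  - exact: FG.
  - move=> d /sub[c cF ->] /=; split; apply: out => // J; [left|right]; assumption.
  exists (c0.1, c0.2 `\` union_of (W n)); split; last exact: c0F.2.
  by exists c0 => //; exact: c0F.1.
case: (ex_minnP exP) => k /asboolP[c [J [cF JW Jk cFG]]] kmin.
have kminFG b (K : {fset set X}) : caught W R s F b -> [set` K] `<=` W n ->
    b.2 `&` F `<=` R n `|` union_of [set` K] \/
    b.2 `&` G `<=` R n `|` union_of [set` K] -> k <= #|` K|.
  by move=> bF KW bK; apply/kmin/asboolP; exists b, K.
exists (Some k).
have fin' : finite_set (caught W R (Some k :: s) F).
  apply: finite_caught_Some => // b K bF KW bK.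
  by apply: kminFG bF KW _; left.
have FG' := FG _ fin'.
have [d [ds dE]] : exists d, config W R (Some k :: s) d /\
    d.1 = c.1 `&` (~` c.2 `|` (R n `|` union_of [set` J])).
  have [J0|[U UJ]] := fset_0Vmem J.
    exists (c.1 `&` (~` c.2 `|` (R n `|` union_of [set` J])), c.2).
    by split => //; exists c, J; split => //; [exact: cF.1|left].
  exists (c.1 `&` (~` c.2 `|` (R n `|` union_of [set` J])),
    c.2 `\` (R n `|` union_of [set` (J `\ U)%fset])).
  by split => //; exists c, J; split => //; [exact: cF.1|right; exists U].
have catch K : caught W R s K c -> c.2 `&` K `<=` R n `|` union_of [set` J] ->
    caught W R (Some k :: s) K d.
  move=> [_ Kc] KJ; split => // x Kx; rewrite dE; split; first exact: Kc.
  by have [cx|ncx] := pselect (c.2 x); [right; apply: KJ|left].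
have survive K b : caught W R s K = caught W R s F ->
    (forall a, caught W R s F a -> a.2 `&` K !=set0) ->
    (forall (a : set X * set X) (J : {fset set X}),
       a.2 `&` K `<=` R n `|` union_of [set` J] ->
       a.2 `&` F `<=` R n `|` union_of [set` J] \/
       a.2 `&` G `<=` R n `|` union_of [set` J]) ->
    caught W R (Some k :: s) K b -> b.2 `&` K !=set0.
  move=> KF Kmeet KFG /caught_Some[a [I [+ [IW Ik] _ b2 KI]]]; rewrite KF => aF.
  case: b2 => [[_ ->]|[U UI ->]]; first exact: Kmeet.
  (* Otherwise [I] without [U] would still cover, with [k - 1] members. *)
  apply: contrapT => e.
  have : k <= #|` (I `\ U)%fset|.
    apply: (kminFG a) => //; first by move=> V /=; rewrite in_fsetD1 => /andP[_ /IW].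
    apply: KFG => x [ax Kx]; apply: contrapT => nx; apply: e.
    by exists x.
  by rewrite -Ik [#|` I|](cardfsD1 U) UI ltnn.
split => //.
(* The optimal cover may concern [G] only; then [d] catches [G], and therefore [F]. *)
- case: cFG => h; exists d; first exact: catch.
  by rewrite FG'; apply: catch => //; rewrite -sFG.
- move=> b bF; split.
    by apply: survive bF => // [a /meet[]//|a I]; left.
  have bG : caught W R (Some k :: s) G b by rewrite -FG'.
  by apply: survive bG => // [a /meet[]//|a I]; right.
Qed.

(** * Unseparated points as a limit along an infinite history *)

Lemma linked_agree {X : topologicalType} (W : nat -> set (set X))
    (R : nat -> set X) (F G : set X) :
  sunflower_families W R -> compact F -> compact G -> F !=set0 -> G !=set0 ->
  (forall t, finite_set (caught W R t F) -> caught W R t F = caught W R t G) ->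
  exists x y, [/\ F x, G y & forall n, agree (W n) x y].
Proof.
move=> WR Fc Gc F0 G0 FG.
have c0 K : caught W R [::] K = [set (setT, setT)].
  by apply/seteqP; split => [c []//|c ->].
have linked0 : linked W R F G [::].
  split; rewrite !c0 //; first by exists (setT, setT).
  by move=> c -> /=; rewrite !setTI.
have /choice[next nextP] : forall s, exists o,
    linked W R F G s -> linked W R F G (o :: s).
  move=> s; have [Ls|nLs] := pselect (linked W R F G s); last by exists None.
  by have [o os] := linked_extend _ _ _ _ _ WR Fc Gc FG Ls; exists o.
pose s n := iter n (fun t => next t :: t) [::].
have sz n : size (s n) = n by elim: n => //= n ->.
have sP n : linked W R F G (s n) by elim: n => //= n; exact: nextP.
(* A finite union of closed sets, decreasing in [n] and always meeting the compact [F * G]; a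
   cluster point will lie in all of them. *)
pose E n := \bigcup_(c in caught W R (s n) F) (c.2 `*` c.2).
have Ecl n : closed (E n).
  have [fin _ _ _] := sP n; apply: closed_bigcup => // c [sc _].
  have [_ cc] := config_open_closed _ _ _ _ WR sc.
  have fst_cont : continuous (@fst X X) by move=> p; exact: cvg_fst.
  have snd_cont : continuous (@snd X X) by move=> p; exact: cvg_snd.
  apply: closedI; first exact: (continuous_closedP _).1 fst_cont _ cc.
  exact: (continuous_closedP _).1 snd_cont _ cc.
have Edecr m n : m <= n -> E n `<=` E m.
  move=> mn; rewrite -(subnK mn); elim: (n - m) => // k IH; apply: subset_trans IH.
  move=> p [d [/config_parent[c [sc dc1 dc2]] Fd] [p1 p2]].
  exists c; last by split; exact: dc2.
  by split => //; exact: subset_trans dc1.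
pose B n := (F `*` G) `&` E n.
have FB : ProperFilter (filter_from setT B).
  apply: filter_from_proper; last first.
    move=> n _; have [_ [c cF] _ meet] := sP n.
    have [[x [cx Fx]] [y [cy Gy]]] := meet c cF.
    by exists (x, y); split => //; exists c.
  apply: filter_from_filter; first by exists 0.
  move=> m n _ _; exists (maxn m n) => // p [FGp Ep]; split; split => //.
    exact: (Edecr _ _ (leq_maxl m n)).
  exact: (Edecr _ _ (leq_maxr m n)).
have [|[x y] [[Fx Gy] cl]] := compact_setX Fc Gc FB; first by exists 0 => // p [].
exists x, y; split => // n.
(* The history of length [n.+1] is the first to have treated [W n]. *)
have : E n.+1 (x, y).
  rewrite (closure_id (E n.+1)).1 //; move: cl; rewrite clusterE; apply.
  by exists n.+1 => // p [].
move=> [d [sd Fd] [/= dx dy]].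
have [_ _ EFG _] := sP n.+1.
have [_ Gd] : caught W R (s n.+1) G d by rewrite -EFG.
rewrite -[n]sz; apply: (config_agree _ _ _ _ d _ _ WR sd); split => //.
  exact: Fd.
exact: Gd.
Qed.

(** * Transfer of the configurations to [Y] *)

Theorem theorem4p1 (X Y : topologicalType) (f : X -> Y)
    (hX : hausdorff_space X) (hY : hausdorff_space Y)
    (gX : gruenhage_space X)
    (f_perfect : perfect_map f) (f_surj : set_surj [set: X] [set: Y] f) :
  gruenhage_space Y.
Proof.
have [_ f_closed f_fibre] := f_perfect.
have [W [R [WR sepW]]] := gruenhage_sunflower gX.
(* This is open when [c.1] is, because [f] is closed. *)
pose core (c : set X * set X) := ~` (f @` ~` c.1).
have coreP c y : core c y <-> f @^-1` [set y] `<=` c.1.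
  split => [cy x /= fx|yc [x ncx fx]]; last exact/ncx/yc.
  by apply: contrapT => ncx; apply: cy; exists x.
(* One family per history, indexed by its code; numbers that decode to no history give the empty
   family. *)
exists (fun n => if choice.unpickle n is Some s then core @` config W R s else set0).
split.
  move=> n U; case: choice.unpickle => // s [c sc <-].
  apply: closed_openC; apply: f_closed; apply: open_closedC.
  by have [] := config_open_closed _ _ _ _ WR sc.
move=> y z yz; set F := f @^-1` [set y]; set G := f @^-1` [set z].
have fibre0 t : f @^-1` [set t] !=set0 by have [x _ <-] := f_surj t I; exists x.
(* Otherwise some points of [F] and [G] would agree on every [W n] and so coincide, although their
   images differ. *)
have [s [fin nFG]] : exists s, finite_set (caught W R s F) /\
    caught W R s F <> caught W R s G.
  apply: contrapT => none.
  have [|x [g [Fx Gg xg]]] :=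
    linked_agree _ _ F G WR (f_fibre y) (f_fibre z) (fibre0 y) (fibre0 z).
    by move=> t fin; apply: contrapT => nFG; apply: none; exists t.
  by apply: yz; rewrite -Fx -Gg (sepW _ _ xg).
have [c [sc ncFG]] : exists c, config W R s c /\ ~ (F `<=` c.1 <-> G `<=` c.1).
  apply: contrapT => none; apply: nFG; apply/seteqP; split => c [sc cK]; split => //;
    apply: contrapT => ncK; apply: none; exists c; split => // -[h1 h2];
    by apply: ncK; first [exact: h1|exact: h2].
exists (choice.pickle s), (core c); rewrite choice.pickleK; split.
- by exists c.
- by apply/(separates_setI1P _ _ _ yz); rewrite !coreP.
(* The members containing [y] are cores of configurations that catch [F]. *)
- left; apply: (@sub_finite_set _ _ (core @` caught W R s F)); last first.
    exact: finite_image.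
  by move=> _ [[d sd <-] /coreP Fd]; exists d.
Qed.
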